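(* Let $p$ be an odd prime, let $t\ge 1$ be an integer, and let $r\in\{0,1,2,3\}$ satisfy $4t+r\le p-2$. Put $$\kappa_0=-2,\qquad \kappa_1=-(1+i),\qquad \kappa_2=-\frac i2,\qquad \kappa_3=\frac{1-i}{12}.$$ Then, in $\mathbb Z_{(p)}[i]$, $$\mathbf G_{4t+r}(p)\equiv \kappa_r\,(4t+r)_r\,p^{r+1}B_{4t}\pmod{p^{r+2}}.$$ Consequently $v_p(\mathbf G_{4t+r}(p))\ge r+1$. Moreover, $$v_p(\mathbf G_{4t+r}(p))=r+1\iff p\nmid \operatorname{num}(B_{4t}),$$ and $$p\mid\operatorname{num}(B_{4t})\iff v_p(\mathbf G_{4t+r}(p))\ge r+2.$$ Thus, if $p\mid\operatorname{num}(B_{4t})$ (i.e. $(p,4t)$ is an irregular pair), the valuations $v_p(\mathbf G_{4t}(p)),v_p(\mathbf G_{4t+1}(p)),v_p(\mathbf G_{4t+2}(p)),v_p(\mathbf G_{4t+3}(p))$ are at least $2,3,4,5$ respectively, for those exponents $4t+r$ that are $\le p-2$.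
   Context: Here $i^2=-1$. For an odd prime $p$ and $n\ge 0$, $\mathbf G_n(p)=\sum_{a=1}^{p-1}\sum_{b=1}^{p-1}(a+bi)^n\in\mathbb Z[i]$. The falling factorial is $(n)_0=1$ and $(n)_r=n(n-1)\cdots(n-r+1)$ for $r\ge1$. $B_n$ denotes the $n$-th Bernoulli number, $\frac{z}{e^z-1}=\sum_{n\ge0}B_n\frac{z^n}{n!}$, and $\operatorname{num}(B_n)$ is the numerator of $B_n$ in lowest terms. $\mathbb Z_{(p)}$ is the localization of $\mathbb Z$ at $(p)$; $x\equiv y\pmod{p^k}$ in $\mathbb Z_{(p)}[i]$ means $x-y\in p^k\mathbb Z_{(p)}[i]$. For $x+yi\in\mathbb Z[i]$, $v_p(x+yi)=\min\{v_p(x),v_p(y)\}$, with $v_p(0)=\infty$. *)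

(* Defs.v *)
(* MathComp (algebra, real-closed, and the extended order of reals). *)
From mathcomp Require Import all_boot all_order all_algebra.
From mathcomp Require Import constructive_ereal.
From mathcomp Require Import complex.

Set Implicit Arguments.
Unset Strict Implicit.
Unset Printing Implicit Defensive.

Import Order.TTheory GRing.Theory Num.Theory.
Local Open Scope ring_scope.

(* A formal power series over rat is its coefficient sequence. *)
Definition ps_mul (f g : nat -> rat) (n : nat) : rat :=
  \sum_(k < n.+1) f k * g (n - k)%N.
Definition ps_X (n : nat) : rat := (n == 1)%:R.
Definition ps_expm1 (n : nat) : rat := if n == 0 then 0 else n`!%:R^-1.

(* Comparing coefficients of z^(m+1) in
   (\sum_n B_n z^n / n!) (e^z - 1) = z  determines B_m from B_0, ..., B_(m-1);
   lemmas bernoulli_egf and bernoulli_unique below. *)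
Fixpoint bernoulli_seq (n : nat) : seq rat :=
  if n is m.+1 then
    let s := bernoulli_seq m in
    rcons s (((m == 0)%:R - \sum_(k < m) 'C(m.+1, k)%:R * s`_k) / m.+1%:R)
  else [::].

Definition bernoulli (n : nat) : rat := (bernoulli_seq n.+1)`_n.

Lemma size_bernoulli_seq n : size (bernoulli_seq n) = n.
Proof. by elim: n => //= n IHn; rewrite size_rcons IHn. Qed.

Lemma nth_bernoulli_seq n k : (k < n)%N -> (bernoulli_seq n)`_k = bernoulli k.
Proof.
elim: n => // n IHn; rewrite ltnS leq_eqVlt => /predU1P[-> //|lt_kn].
by rewrite /= nth_rcons size_bernoulli_seq lt_kn IHn.
Qed.

Lemma bernoulli_rec n :
  \sum_(k < n.+1) 'C(n.+1, k)%:R * bernoulli k = (n == 0)%:R.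
Proof.
rewrite big_ord_recr /= [X in _ + _ * X]/bernoulli /=.
rewrite nth_rcons size_bernoulli_seq ltnn eqxx binSn.
rewrite mulrC divfK ?pnatr_eq0 //.
under eq_bigr => k _ do rewrite -(nth_bernoulli_seq (ltn_ord k)).
by rewrite addrC subrK.
Qed.

Lemma ps_mul_expm1 (b : nat -> rat) n :
  ps_mul (fun k => b k / k`!%:R) ps_expm1 n.+1
  = (\sum_(k < n.+1) 'C(n.+1, k)%:R * b k) / n.+1`!%:R.
Proof.
rewrite /ps_mul big_ord_recr /= subnn mulr0 addr0 mulr_suml.
apply: eq_bigr => k _; rewrite /ps_expm1 subn_eq0 leqNgt ltn_ord /=.
have /(congr1 (fun m => m%:R : rat)) := bin_fact (ltnW (ltn_ord k)).
rewrite !natrM => <-; rewrite !invfM [_ * b k]mulrC [RHS]mulrA mulfK ?mulrA //.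
by rewrite pnatr_eq0 -lt0n bin_gt0 ltnW.
Qed.

Theorem bernoulli_egf :
  ps_mul (fun n => bernoulli n / n`!%:R) ps_expm1 =1 ps_X.
Proof.
case=> [|n]; first by rewrite /ps_mul big_ord1 mulr0.
rewrite ps_mul_expm1 bernoulli_rec /ps_X.
by case: n => [|n] /=; rewrite ?divr1 ?mul0r.
Qed.

Theorem bernoulli_unique (b : nat -> rat) :
  ps_mul (fun n => b n / n`!%:R) ps_expm1 =1 ps_X -> b =1 bernoulli.
Proof.
move=> bE n; elim/ltn_ind: n => n IHn.
have fact_neq0 : n.+1`!%:R^-1 != 0 :> rat.
  by rewrite invr_eq0 pnatr_eq0 -lt0n fact_gt0.
have := ftrans bE (fsym bernoulli_egf) n.+1.
rewrite !ps_mul_expm1 => /(mulIf fact_neq0); rewrite !big_ord_recr /= binSn.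
under eq_bigr => k _ do rewrite IHn //.
by move=> /addrI/mulfI; apply; rewrite pnatr_eq0.
Qed.

(* All Gaussian numbers live in rat[i] = Q(i). *)
Definition gauss_int : pred rat[i] :=
  [pred z | (complex.Re z \is a Num.int) && (complex.Im z \is a Num.int)].

Definition loc_int (p : nat) : pred rat := [pred x | ~~ (p %| denq x)%Z].

Definition gauss_loc_int (p : nat) : pred rat[i] :=
  [pred z | (complex.Re z \in loc_int p) && (complex.Im z \in loc_int p)].

Definition gauss_loc_eqmod (p k : nat) (x y : rat[i]) : Prop :=
  [/\ x \in gauss_loc_int p, y \in gauss_loc_int p &
      exists2 w, w \in gauss_loc_int p & x - y = p%:R ^+ k * w].

(* The p-adic valuation on rat, hence on Q(i) coordinatewise. *)
Definition vp_rat (p : nat) (x : rat) : \bar int :=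
  if x == 0 then +oo%E
  else ((logn p `|numq x|)%:Z - (logn p `|denq x|)%:Z)%:E.

Definition vp (p : nat) (z : rat[i]) : \bar int :=
  Order.min (vp_rat p (complex.Re z)) (vp_rat p (complex.Im z)).

Definition gauss_power_sum (n p : nat) : rat[i] :=
  \sum_(1 <= a < p) \sum_(1 <= b < p) (Complex a%:R b%:R) ^+ n.

Lemma gauss_power_sum_int n p : gauss_power_sum n p \in gauss_int.
Proof.
have add0 : 0 \in gauss_int by [].
have addI x y : x \in gauss_int -> y \in gauss_int -> x + y \in gauss_int.
  by case: x y => [a b] [c d] /andP[/= ? ?] /andP[/= ? ?];
    apply/andP; split; apply: rpredD.
have mulI x y : x \in gauss_int -> y \in gauss_int -> x * y \in gauss_int.
  by case: x y => [a b] [c d] /andP[/= ? ?] /andP[/= ? ?];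
    apply/andP; split; rewrite /= ?rpredB ?rpredD ?rpredM.
apply: (big_ind (fun z => z \in gauss_int)) => // a _.
apply: (big_ind (fun z => z \in gauss_int)) => // b _.
elim: n => [|n IHn]; first by rewrite expr0; apply/andP.
by rewrite exprS mulI //; apply/andP; rewrite /= !natr_int.
Qed.

Definition kappa (r : nat) : rat[i] :=
  let I : rat[i] := Complex 0 1 in
  nth 0 [:: - 2; - (1 + I); - (I / 2); (1 - I) / 12] r.

(* Main.v *)
Require Import Defs.
From HB Require Import structures.
From mathcomp Require Import all_boot all_order all_algebra.
From mathcomp Require Import constructive_ereal.
From mathcomp Require Import complex ring.
From Stdlib Require Import FunctionalExtensionality.

Set Implicit Arguments.
Unset Strict Implicit.
Unset Printing Implicit Defensive.

Import Order.TTheory GRing.Theory Num.Theory.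
Local Open Scope ring_scope.

(** Everything is read off from exponential generating functions, represented
by their coefficient sequences: the product of two such series is the binomial
convolution [conv], and substituting u z for z is [twist u]. Write
B(z) = z / (e^z - 1) and F(z) = (e^(pz) - 1) / (pz), whose coefficients are
p^k / (k+1) ([geom_quot]). Then the series T(z) of the power sums
0^n + 1^n + ... + (p-1)^n is p B(z) F(z) ([power_sumE]), and since
(a + bi)^n is the n-th coefficient of e^(az) e^(biz), the series of the
Gaussian sums G_n is
  (T(z) - 1) (T(iz) - 1)
    = p^2 K(z) F(z) F(iz) - p B(z) F(z) - p B(iz) F(iz) + 1,
with K(z) = B(z) B(iz) ([gauss_power_sum_conv]).

For n <= p - 2 all the Bernoulli numbers and all the denominators k + 1 that
occur in the n-th coefficient are prime to p, so F may be expanded in powers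
of p: modulo p^5 this writes G_n as a combination of K_n, K_(n-1), K_(n-2) and
B_n, ..., B_(n-3) ([gauss_power_sum_expansion]).

It remains to know K. From B(-z) = B(z) + z one gets
  K(iz) = B(iz) B(-z) = K(z) + z B(iz),
that is (i^n - 1) K_n = n i^(n-1) B_(n-1) ([bern_conv_twist]): K_n is an
explicit multiple of B_(n-1) unless 4 divides n, and vanishes when
n = 2 mod 4 and n > 2 because B_(n-1) = 0. Substituting this, for n = 4t + r
with r <= 3 all the terms of order p^m with m <= r cancel and the one of order
p^(r+1) is the announced multiple of B_(4t) ([gauss_power_sum_congr]). When
r = 0 the unknown K_(4t) is harmless, being multiplied by p^2. Finally kappa_r
and the falling factorial are units at p, so the valuation of G_n detects
whether p divides the numerator of B_(4t) ([vp_ge_unit_mul]). *)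

(** * Binomial convolution of sequences *)

Section BinomialConvolution.
Variable R : comNzRingType.
Implicit Types (a b c : nat -> R) (u v : R) (n : nat).

Definition conv a b n : R := \sum_(k < n.+1) 'C(n, k)%:R * a k * b (n - k)%N.
(** On exponential generating functions, [shift] is d/dz. *)
Definition shift a n : R := a n.+1.
Definition delta (j : nat) n : R := (n == j)%:R.
Definition geom u n : R := u ^+ n.
Definition twist u a n : R := u ^+ n * a n.

Lemma conv0 a b : conv a b 0%N = a 0%N * b 0%N.
Proof. by rewrite /conv big_ord1 bin0 mul1r. Qed.

(** The Leibniz rule for [shift]. Together with [conv0] it determines [conv],
which is how the ring laws below are proved: by induction on the index, without
manipulating binomial coefficients. *)
Lemma convS a b n :
  conv a b n.+1 = conv (shift a) b n + conv a (shift b) n.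
Proof.
rewrite /conv /shift big_ord_recl /= bin0 mul1r subn0.
under eq_bigr => k _ do rewrite binS natrD mulrDl mulrDl subSS.
rewrite big_split /= addrA addrC; congr (_ + _).
rewrite [RHS]big_ord_recl /= bin0 mul1r subn0; congr (_ + _).
rewrite big_ord_recr /= bin_small // mul0r mul0r addr0.
by apply: eq_bigr => k _; rewrite /bump /= add1n subnSK.
Qed.

Lemma convDl a b c n :
  conv (fun k => a k + b k) c n = conv a c n + conv b c n.
Proof. by rewrite -big_split; apply: eq_bigr => k _; rewrite /=; ring. Qed.

Lemma convZl u a b n : conv (fun k => u * a k) b n = u * conv a b n.
Proof. by rewrite mulr_sumr; apply: eq_bigr => k _; ring. Qed.

Lemma convC a b : conv a b = conv b a.
Proof.
apply: functional_extensionality => n.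
elim: n a b => [|n IHn] a b; first by rewrite !conv0 mulrC.
by rewrite !convS addrC (IHn a (shift b)) (IHn b (shift a)).
Qed.

Lemma shift_conv a b :
  shift (conv a b) = fun n => conv (shift a) b n + conv a (shift b) n.
Proof. by apply: functional_extensionality => n; rewrite /shift convS. Qed.

Lemma convDr a b c n :
  conv c (fun k => a k + b k) n = conv c a n + conv c b n.
Proof. by rewrite convC convDl !(convC c). Qed.

Lemma convZr u a b n : conv b (fun k => u * a k) n = u * conv b a n.
Proof. by rewrite convC convZl (convC b). Qed.

Lemma convBl a b c n :
  conv (fun k => a k - b k) c n = conv a c n - conv b c n.
Proof. by rewrite -sumrB; apply: eq_bigr => k _; ring. Qed.

Lemma convBr a b c n :
  conv c (fun k => a k - b k) n = conv c a n - conv c b n.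
Proof. by rewrite convC convBl !(convC c). Qed.

Lemma convA a b c : conv a (conv b c) = conv (conv a b) c.
Proof.
apply: functional_extensionality => n.
elim: n a b c => [|n IHn] a b c; first by rewrite !conv0 mulrA.
by rewrite !convS !shift_conv convDl convDr !IHn addrA.
Qed.

Lemma convCA a b c : conv a (conv b c) = conv b (conv a c).
Proof. by rewrite !convA (convC a). Qed.

Lemma conv0l a n : conv (fun=> 0) a n = 0.
Proof. by rewrite /conv big1 // => k _; rewrite mulr0 mul0r. Qed.

Lemma conv_delta0 a : conv (delta 0) a = a.
Proof.
apply: functional_extensionality => n.
elim: n a => [|n IHn] a; first by rewrite conv0 mul1r.
by rewrite convS (_ : shift (delta 0) = fun=> 0) // conv0l add0r IHn.
Qed.

(** [delta 1] is the series z. At n = 0 the value of [n.-1] is immaterial, being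
multiplied by 0. *)
Lemma conv_delta1 a n : conv (delta 1) a n = n%:R * a n.-1.
Proof.
elim: n a => [|n IHn] a; first by rewrite conv0 !mul0r.
rewrite convS (_ : shift (delta 1) = delta 0) // conv_delta0 IHn /shift.
case: n {IHn} => [|n]; rewrite /= ?mul0r ?mul1r ?addr0 //.
by rewrite -[n.+2]addn1 natrD; ring.
Qed.

(** The functional equation of the exponential, as [geom u] is the series
e^(uz); by induction since shifting [geom u] multiplies it by u. *)
Lemma conv_geom u v : conv (geom u) (geom v) = geom (u + v).
Proof.
have shiftE w : shift (geom w) = fun n => w * geom w n.
  by apply: functional_extensionality => n; rewrite /shift /geom exprS.
apply: functional_extensionality.
elim=> [|n IHn]; first by rewrite conv0 /geom !expr0 mulr1.
by rewrite convS !shiftE convZl convZr IHn -mulrDl /geom exprS.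
Qed.

Lemma twist_conv u a b : twist u (conv a b) = conv (twist u a) (twist u b).
Proof.
apply: functional_extensionality => n.
rewrite /twist /conv mulr_sumr; apply: eq_bigr => k _.
by rewrite -{1}(subnKC (leq_ord k)) exprD; ring.
Qed.

Lemma geom0 : geom (0 : R) = delta 0.
Proof. by apply: functional_extensionality => n; rewrite /geom expr0n. Qed.

Lemma twist_geom u v : twist u (geom v) = geom (u * v).
Proof.
by apply: functional_extensionality => n; rewrite /twist /geom exprMn.
Qed.

Lemma twist_twist u v a : twist u (twist v a) = twist (u * v) a.
Proof.
by apply: functional_extensionality => n; rewrite /twist exprMn mulrA.
Qed.

Lemma twist_delta1 u : twist u (delta 1) = fun n => u * delta 1 n.
Proof.
by apply: functional_extensionality => -[|[|n]]; rewrite /twist /delta ?mulr0.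
Qed.

End BinomialConvolution.
Arguments delta {R}.

(** * Bernoulli numbers and the convolution K = B(z) B(iz) *)

Local Notation I := (Complex (0 : rat) 1).
Local Notation toC := (real_complex rat).

Lemma I_sqr : I * I = -1.
Proof. by apply/eqP. Qed.

Lemma pnatC_neq0 n : (n.+1%:R : rat[i]) != 0.
Proof.
by rewrite -(rmorph_nat toC) eq_complex /= eqxx andbT pnatr_eq0.
Qed.

Lemma natC_neq0 n : (0 < n)%N -> (n%:R : rat[i]) != 0.
Proof. by case: n => // n _; apply: pnatC_neq0. Qed.

(** The series z may be cancelled in characteristic 0. This replaces every
division of series: an identity is proved after multiplying by z, that is by
B(z) (e^z - 1). *)
Lemma conv_delta1_inj (a b : nat -> rat[i]) :
  conv (delta 1) a = conv (delta 1) b -> a = b.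
Proof.
move=> eq_ab; apply: functional_extensionality => n.
have := congr1 (fun f => f n.+1) eq_ab.
by rewrite !conv_delta1; apply: mulfI (pnatC_neq0 n) _ _.
Qed.

Definition bern n : rat[i] := (bernoulli n)%:C%C.

Lemma conv_bern_geom1 : conv bern (geom 1) = fun n => bern n + delta 1 n.
Proof.
apply: functional_extensionality => -[|n].
  by rewrite conv0 /geom /delta expr0 mulr1 addr0.
rewrite /conv big_ord_recr /= binn subnn mul1r /geom expr0 mulr1 addrC.
congr (_ + _).
rewrite /delta eqSS -(rmorph_nat toC) -bernoulli_rec rmorph_sum /=.
by apply: eq_bigr => k _; rewrite expr1n mulr1 rmorphM /= rmorph_nat.
Qed.

(** The defining identity B(z) (e^z - 1) = z, times the series of [a]: it turns
a goal produced by [conv_delta1_inj] into one about multiplication by e^z - 1,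
B(z) being then a common factor. *)
Lemma conv_bern_expm1 a :
  conv bern (conv a (fun n => geom 1 n - delta 0 n)) = conv (delta 1) a.
Proof.
rewrite convCA (convC (delta 1)); congr conv.
apply: functional_extensionality => n.
by rewrite convBr conv_bern_geom1 (convC bern) conv_delta0 addrAC subrr add0r.
Qed.

(** This is B(-z) = B(z) + z. Twisting B(z) e^z = B(z) + z by -1 gives
B(-z) e^(-z) = B(-z) - z, and the left-hand side is B(z): multiplying it by
e^z - 1 gives B(-z) - (B(-z) - z) = z. *)
Lemma twist_bern : twist (-1) bern = fun n => bern n + delta 1 n.
Proof.
have twE : conv (twist (-1) bern) (geom (-1)) =
           fun n => twist (-1) bern n - delta 1 n.
  have -> : geom (-1 : rat[i]) = twist (-1) (geom 1) by rewrite twist_geom mulr1.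
  rewrite -twist_conv conv_bern_geom1; apply: functional_extensionality => n.
  rewrite {1}/twist mulrDr -/(twist _ _ n) -/(twist _ (delta 1) n).
  by rewrite twist_delta1 mulN1r.
suff bE : conv (twist (-1) bern) (geom (-1)) = bern.
  by apply: functional_extensionality => n; rewrite -[in RHS]bE twE subrK.
apply: conv_delta1_inj; rewrite -conv_bern_expm1 (convC _ bern); congr conv.
apply: functional_extensionality => n.
rewrite convBr -convA conv_geom addNr geom0 !(convC _ (delta 0)) !conv_delta0.
by rewrite twE subKr.
Qed.

Definition bern_conv : nat -> rat[i] := conv bern (twist I bern).

(** Replacing z by iz turns K(z) = B(z) B(iz) into B(iz) B(-z), and
B(-z) = B(z) + z. *)
Lemma bern_conv_twist n :
  I ^+ n * bern_conv n = bern_conv n + n%:R * (I ^+ n.-1 * bern n.-1).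
Proof.
rewrite -/(twist I bern_conv n) {1}/bern_conv twist_conv twist_twist I_sqr.
by rewrite twist_bern convDr (convC _ bern) (convC _ (delta 1)) conv_delta1.
Qed.

Lemma bern_odd n : odd n -> (1 < n)%N -> bern n = 0.
Proof.
move=> n_odd n_gt1; have := congr1 (fun f => f n) twist_bern.
rewrite /twist -signr_odd n_odd mulN1r /delta gtn_eqF // addr0 => /esym/eqP.
by rewrite -addr_eq0 -mulr2n -mulr_natl mulf_eq0 (negPf (pnatC_neq0 1)) => /eqP.
Qed.

(** The next three lemmas solve [bern_conv_twist] for the indices that are 1, 2
and 3 modulo 4; at the multiples of 4 that equation does not involve K. *)
Lemma bern_conv_mod1 q : I ^+ q = 1 ->
  bern_conv q.+1 = - ((1 + I) / 2) * q.+1%:R * bern q.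
Proof.
move=> Iq; have := bern_conv_twist q.+1; rewrite exprSr Iq !mul1r => H.
have : (I - 1) * bern_conv q.+1 = q.+1%:R * bern q.
  by rewrite mulrBl H; ring.
(* The factor is the inverse of I - 1, as (I - 1) * (I + 1) = - 2. *)
move=> KE; rewrite -mulrA -KE.
by field: I_sqr; exact: pnatC_neq0.
Qed.

Lemma bern_conv_mod2 q : I ^+ q = 1 -> bern q.+1 = 0 -> bern_conv q.+2 = 0.
Proof.
move=> Iq bq; have := bern_conv_twist q.+2; rewrite bq !mulr0 addr0.
rewrite !exprS Iq mulr1 I_sqr mulN1r => /eqP.
rewrite eq_sym -addr_eq0 -mulr2n -mulr_natl mulf_eq0 (negPf (pnatC_neq0 1)).
by move=> /eqP.
Qed.

Lemma bern_conv_mod3 q : I ^+ q = 1 ->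
  bern_conv q.+3 = (1 - I) / 2 * q.+3%:R * bern q.+2.
Proof.
move=> Iq; have := bern_conv_twist q.+3; rewrite !exprS Iq !mulr1 I_sqr => H.
have KE : (1 + I) * bern_conv q.+3 = q.+3%:R * bern q.+2.
  transitivity (bern_conv q.+3 - I * -1 * bern_conv q.+3); first by ring.
  by rewrite H /=; ring.
rewrite -mulrA -KE.
by field: I_sqr; exact: pnatC_neq0.
Qed.

(** * Power sums and Gaussian power sums as convolutions *)

Definition power_sum (m n : nat) : rat[i] := \sum_(a < m) a%:R ^+ n.
(** The series (e^(uz) - 1) / (uz). *)
Definition geom_quot (u : rat[i]) n : rat[i] := u ^+ n / n.+1%:R.

(** Faulhaber's formula. After multiplication by z = B(z) (e^z - 1), it says
that the series T(z) of the power sums satisfies T(z) (e^z - 1) = e^(mz) - 1,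
which telescopes. *)
Lemma power_sumE (m : nat) n :
  power_sum m n = m%:R * conv bern (geom_quot m%:R) n.
Proof.
rewrite -convZr; congr (_ n); apply: conv_delta1_inj.
rewrite -conv_bern_expm1 [RHS]convCA; congr conv.
apply: functional_extensionality => k.
rewrite conv_delta1 convBr (convC _ (delta 0)) conv_delta0.
have -> : conv (power_sum m) (geom 1) k = \sum_(a < m) a.+1%:R ^+ k.
  elim: m => [|m IHm].
    rewrite big_ord0 (_ : power_sum 0 = fun=> 0) ?conv0l //.
    by apply: functional_extensionality => j; rewrite /power_sum big_ord0.
  rewrite big_ord_recr /= -IHm -natr1 -/(geom (m%:R + 1) k) -conv_geom -convDl.
  congr (conv _ _ k).
  by apply: functional_extensionality => j; rewrite /power_sum big_ord_recr.
transitivity (m%:R ^+ k - delta 0 k : rat[i]).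
  rewrite /power_sum.
  elim: m => [|m IHm]; first by rewrite !big_ord0 expr0n /delta !subrr.
  by rewrite !big_ord_recr /= opprD addrACA IHm; ring.
case: k => [|k]; first by rewrite mul0r expr0 subrr.
rewrite /delta /= subr0 /geom_quot mulrCA /= exprS; congr (_ * _).
by rewrite mulrC divfK ?pnatC_neq0.
Qed.

(** The omission of a = 0 and b = 0 in the Gaussian power sum turns T(z) into
T(z) - 1; the linear terms of (T(z) - 1) (T(iz) - 1) produce the factor
1 + i^n. *)
Lemma gauss_power_sum_conv (p n : nat) : (0 < p)%N -> (0 < n)%N ->
  gauss_power_sum n p = p%:R ^+ 2 *
    conv (geom_quot p%:R) (conv (twist I (geom_quot p%:R)) bern_conv) n
  - (1 + I ^+ n) * (p%:R * conv (geom_quot p%:R) bern n).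
Proof.
move=> p_gt0 n_gt0; set S := power_sum p.
have SE k : S k - delta 0 k = \sum_(1 <= a < p) a%:R ^+ k.
  rewrite /S /power_sum -(big_mkord xpredT (fun a => a%:R ^+ k : rat[i])).
  by rewrite big_ltn // expr0n addrAC subrr add0r.
transitivity (conv (fun k => S k - delta 0 k)
                   (twist I (fun k => S k - delta 0 k)) n).
  rewrite /gauss_power_sum /conv.
  under [RHS]eq_bigr => k _.
    rewrite /twist !SE ['C(_, _)%:R * _]mulr_sumr [I ^+ _ * _]mulr_sumr.
    rewrite big_distrlr /=.
    over.
  rewrite [RHS]exchange_big; apply: eq_bigr => a _.
  rewrite [RHS]exchange_big; apply: eq_bigr => b _.
  have -> : Complex a%:R b%:R = a%:R + I * b%:R :> rat[i].
    rewrite -!(rmorph_nat toC); apply/eqP; rewrite eq_complex /=.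
    by rewrite !(mul0r, mul1r, mulr0, subr0, addr0, add0r) !eqxx.
  rewrite -/(geom _ n) -conv_geom; apply: eq_bigr => k _.
  by rewrite /geom exprMn.
have tSE : twist I (fun k => S k - delta 0 k) = fun k => twist I S k - delta 0 k.
  apply: functional_extensionality => -[|k]; first by rewrite /twist !mul1r.
  by rewrite /twist /delta !subr0.
rewrite tSE convBl !convBr (convC S (delta 0)) !conv_delta0.
have SF : S = fun k => p%:R * conv bern (geom_quot p%:R) k.
  by apply: functional_extensionality => k; apply: power_sumE.
have tSF : twist I S =
    fun k => p%:R * conv (twist I bern) (twist I (geom_quot p%:R)) k.
  by apply: functional_extensionality => k; rewrite -twist_conv SF /twist; ring.
have -> : conv S (twist I S) n = p%:R ^+ 2 *
    conv (geom_quot p%:R) (conv (twist I (geom_quot p%:R)) bern_conv) n.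
  rewrite tSF {1}SF convZl convZr mulrA -expr2; congr (_ * _).
  rewrite (convC bern) (convC (twist I bern)) -!convA; congr (conv _ _ n).
  by rewrite convCA.
rewrite (_ : delta 0 n = 0) /delta ?gtn_eqF // subr0 /twist.
by rewrite {1 2}SF (convC bern); ring.
Qed.

(** * Integrality at p *)

Lemma dvdz_denq (x : rat) (d : int) : x * d%:~R \is a Num.int -> (denq x %| d)%Z.
Proof.
move=> /intrP[m xd].
have : (denq x %| numq x * d)%Z.
  apply/dvdzP; exists m; apply: (@intr_inj rat).
  by rewrite !intrM numqE -xd; ring.
by rewrite Gauss_dvdzr // coprimez_sym; apply: coprime_num_den.
Qed.

(** Decomposes membership in a subring; leaves are looked up in the context. *)
Ltac loc_closed := repeat lazymatch goal with
  | |- is_true (_ + _ \in _) => apply: rpredD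
  | |- is_true (- _ \in _) => rewrite rpredN
  | |- is_true (_ * _ \in _) => apply: rpredM
  | |- is_true (_ ^+ _ \in _) => apply: rpredX
  | |- is_true (1 \in _) => apply: rpred1
  | |- is_true (_%:R \in _) => apply: rpred_nat
  | |- is_true (_^-1 \in _) => by auto
  | |- _ => by auto
  end.

Section Localization.
Variables (p : nat) (p_prime : prime p).

(** The sets [loc_int p] and [gauss_loc_int p] are subrings for prime p only, so
the proof of primality is made part of the predicate in order to register them
as such. *)
Definition loc of prime p : {pred rat} := loc_int p.
Definition gauss_loc of prime p : {pred rat[i]} := gauss_loc_int p.

Lemma loc_frac (x : rat) (d : int) :
  ~~ (p %| d)%Z -> x * d%:~R \is a Num.int -> x \in loc p_prime.
Proof.
move=> p_ndiv_d /dvdz_denq dvd_d; apply: contra p_ndiv_d => p_div.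
exact: dvdz_trans dvd_d.
Qed.

Lemma loc_subring : subring_closed (loc p_prime).
Proof.
have ndivM (x y : int) : ~~ (p %| x)%Z -> ~~ (p %| y)%Z -> ~~ (p %| x * y)%Z.
  by rewrite /dvdz !unfold_in /= abszM Euclid_dvdM // => /negPf-> /negPf->.
split=> [|x y xl yl|x y xl yl].
- by apply: (@loc_frac 1 1) => //; rewrite dvdz1 absz_nat gtn_eqF ?prime_gt1.
- apply: (loc_frac (ndivM _ _ xl yl)); rewrite intrM mulrBl.
  rewrite mulrA -numqE [y * _]mulrCA -numqE -!intrM -intrB; exact: intr_int.
- apply: (loc_frac (ndivM _ _ xl yl)); rewrite intrM mulrACA -!numqE -intrM.
  exact: intr_int.
Qed.

HB.instance Definition _ :=
  GRing.isSubringClosed.Build rat (loc p_prime) loc_subring.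

Lemma gauss_loc_subring : subring_closed (gauss_loc p_prime).
Proof.
split=> [|[a b] [c d] /andP[al bl] /andP[cl dl]
         |[a b] [c d] /andP[al bl] /andP[cl dl]].
- apply/andP; split; first exact: (rpred1 (loc p_prime)).
  exact: (rpred0 (loc p_prime)).
- apply/andP; split; exact: (@rpredB _ (loc p_prime)).
- apply/andP; split.
    by apply: (@rpredB _ (loc p_prime)); exact: (@rpredM _ (loc p_prime)).
  by apply: (@rpredD _ (loc p_prime)); exact: (@rpredM _ (loc p_prime)).
Qed.

HB.instance Definition _ :=
  GRing.isSubringClosed.Build rat[i] (gauss_loc p_prime) gauss_loc_subring.

Lemma gauss_loc_I : I \in gauss_loc p_prime.
Proof.
apply/andP; split; [exact: (rpred0 (loc p_prime))|exact: (rpred1 (loc p_prime))].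
Qed.

Lemma loc_inv_nat n : ~~ (p %| n)%N -> n%:R^-1 \in loc p_prime.
Proof.
move=> p_ndiv; have n_neq0 : (n%:R : rat) != 0.
  by rewrite pnatr_eq0; apply: contra p_ndiv => /eqP->.
by apply: (@loc_frac _ n) => //; rewrite mulVf ?rpred1.
Qed.

Lemma gauss_locC x : x \in loc p_prime -> x%:C%C \in gauss_loc p_prime.
Proof. by move=> xl; apply/andP; split=> //; apply: (rpred0 (loc p_prime)). Qed.

Lemma gauss_loc_inv_nat n : ~~ (p %| n)%N -> n%:R^-1 \in gauss_loc p_prime.
Proof.
by move=> /loc_inv_nat/gauss_locC; rewrite fmorphV rmorph_nat.
Qed.

(** The recursion for the Bernoulli numbers up to B_n only divides by
1, ..., n + 1. *)
Lemma bern_loc n : (n.+1 < p)%N -> bern n \in gauss_loc p_prime.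
Proof.
elim/ltn_ind: n => n IHn n_lt.
have := bernoulli_rec n; rewrite big_ord_recr /= binSn.
move/(congr1 toC); rewrite rmorphD rmorph_sum rmorphM /= !rmorph_nat => recE.
suff -> : bern n =
    ((n == 0)%:R - \sum_(k < n) 'C(n.+1, k)%:R * bern k) / n.+1%:R.
  apply: rpredM; last first.
    by apply: gauss_loc_inv_nat; rewrite gtnNdvd.
  rewrite rpredB ?rpred_nat // rpred_sum // => k _.
  by rewrite rpredM ?rpred_nat ?IHn ?(leq_trans _ n_lt) // !ltnS ltnW.
rewrite -recE (eq_bigr (fun k : 'I_n => 'C(n.+1, k)%:R * bern k)).
  by rewrite addrAC subrr add0r mulrC mulKf // pnatC_neq0.
by move=> k _; rewrite rmorphM /= rmorph_nat.
Qed.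

Lemma conv_loc (a b : nat -> rat[i]) n :
  (forall k, (k <= n)%N -> a k \in gauss_loc p_prime) ->
  (forall k, (k <= n)%N -> b k \in gauss_loc p_prime) ->
  conv a b n \in gauss_loc p_prime.
Proof.
move=> al bl; apply: rpred_sum => k _.
by rewrite !rpredM ?rpred_nat ?al ?bl ?leq_subr // -ltnS.
Qed.

Lemma twist_loc u (a : nat -> rat[i]) n :
  u \in gauss_loc p_prime -> a n \in gauss_loc p_prime ->
  twist u a n \in gauss_loc p_prime.
Proof. by move=> ul al; rewrite rpredM ?rpredX. Qed.


(** The k-th coefficient of (e^(puz) - 1) / (puz) is divisible by p^k, so that
cutting the convolution after m terms leaves a multiple of p^m. *)
Lemma conv_geom_quot m u (a : nat -> rat[i]) n :
  u \in gauss_loc p_prime ->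
  (forall k, (k <= n)%N -> a k \in gauss_loc p_prime) ->
  (n.+1 < p)%N -> (m <= n.+1)%N ->
  exists2 w, w \in gauss_loc p_prime &
    conv (geom_quot (p%:R * u)) a n =
      \sum_(j < m) (p%:R * u) ^+ j * ((n ^_ j)%:R / j.+1`!%:R) * a (n - j)%N
      + p%:R ^+ m * w.
Proof.
move=> ul al n_lt m_le.
exists (\sum_(m <= j < n.+1)
  'C(n, j)%:R * (p%:R ^+ (j - m) * u ^+ j / j.+1%:R) * a (n - j)%N).
  rewrite big_nat rpred_sum // => j /andP[_ j_lt].
  rewrite !rpredM ?rpredX ?rpred_nat ?al ?leq_subr //.
  by rewrite gauss_loc_inv_nat // gtnNdvd // (leq_ltn_trans _ n_lt).
rewrite /conv -(big_mkord xpredT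
  (fun j => 'C(n, j)%:R * geom_quot (p%:R * u) j * a (n - j)%N)).
rewrite (big_cat_nat (n := m)) //= big_mkord; congr (_ + _).
  apply: eq_bigr => j _; rewrite /geom_quot -bin_ffact factS !natrM.
  by field; rewrite nat1r !natC_neq0 ?fact_gt0.
rewrite mulr_sumr; apply: eq_big_nat => j /andP[m_le_j _].
have pE : p%:R ^+ j = p%:R ^+ m * p%:R ^+ (j - m) :> rat[i].
  by rewrite -exprD subnKC.
by rewrite /geom_quot exprMn pE; ring.
Qed.


Lemma twist_geom_quot u v : twist u (geom_quot v) = geom_quot (v * u).
Proof.
apply: functional_extensionality => n.
by rewrite /twist /geom_quot exprMn; ring.
Qed.

Lemma bern_conv_loc n : (n.+1 < p)%N -> bern_conv n \in gauss_loc p_prime.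
Proof.
move=> n_lt; have lt k : (k <= n)%N -> (k.+1 < p)%N.
  by move=> k_le; apply: leq_ltn_trans n_lt.
by apply: conv_loc => k /lt kl; rewrite ?twist_loc ?gauss_loc_I ?bern_loc.
Qed.

(** The quadratic part needs F(z) F(iz) modulo p^3 and the linear part F(z)
modulo p^4. The first one is
F(z) F(iz) = 1 + (1 + i)/2 pz + i/4 p^2 z^2 modulo p^3: the terms in z^2 coming
from F(z) and from F(iz) alone are p^2 z^2 / 6 and - p^2 z^2 / 6. *)
Lemma gauss_power_sum_expansion k : (k.+4 < p)%N ->
  let n : rat[i] := k.+3%:R in let n1 : rat[i] := k.+2%:R in
  let n2 : rat[i] := k.+1%:R in let P : rat[i] := p%:R in
  exists2 w, w \in gauss_loc p_prime &
    gauss_power_sum k.+3 p =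
      P ^+ 2 * (bern_conv k.+3 + (1 + I) / 2 * P * n * bern_conv k.+2
                + I / 4 * P ^+ 2 * n * n1 * bern_conv k.+1)
    - (1 + I ^+ k.+3) * P * (bern k.+3 + P * n / 2 * bern k.+2
          + P ^+ 2 * n * n1 / 6 * bern k.+1
          + P ^+ 3 * n * n1 * n2 / 24 * bern k)
    + P ^+ 5 * w.
Proof.
move=> k_lt n n1 n2 P.
have ltk j : (j <= k.+3)%N -> (j.+1 < p)%N.
  by move=> j_le; apply: leq_ltn_trans k_lt.
have Kl j : (j <= k.+3)%N -> bern_conv j \in gauss_loc p_prime.
  by move=> /ltk; apply: bern_conv_loc.
have inv j : (0 < j < 5)%N -> j%:R^-1 \in gauss_loc p_prime.
  case/andP=> j_gt0 j_lt; rewrite gauss_loc_inv_nat // gtnNdvd //.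
  by apply: leq_trans k_lt; rewrite (leq_trans j_lt).
have il := gauss_loc_I.
pose L := conv (twist I (geom_quot P)) bern_conv.
have Lexp m j : (j <= k.+3)%N -> (m <= j.+1)%N ->
    exists2 w, w \in gauss_loc p_prime &
    L j = \sum_(l < m) (P * I) ^+ l * ((j ^_ l)%:R / l.+1`!%:R)
                        * bern_conv (j - l)%N
      + P ^+ m * w.
  move=> j_le m_le; rewrite /L twist_geom_quot; apply: conv_geom_quot => //.
    by move=> l l_le; apply: Kl; apply: leq_trans j_le.
  exact: ltk.
have Ll j : (j <= k.+3)%N -> L j \in gauss_loc p_prime.
  move=> j_le; have [w wl ->] := Lexp 0 j j_le isT.
  by rewrite big_ord0 add0r expr0 mul1r.
have bl j : (j <= k.+3)%N -> bern j \in gauss_loc p_prime.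
  by move=> /ltk; apply: bern_loc.
have exp1 m (a : nat -> rat[i]) :
    (forall j, (j <= k.+3)%N -> a j \in gauss_loc p_prime) -> (m <= k.+4)%N ->
    exists2 w, w \in gauss_loc p_prime &
    conv (geom_quot P) a k.+3 =
      \sum_(l < m) P ^+ l * ((k.+3 ^_ l)%:R / l.+1`!%:R) * a (k.+3 - l)%N
      + P ^+ m * w.
  move=> al m_le.
  have := conv_geom_quot (rpred1 (gauss_loc p_prime)) al k_lt m_le.
  by rewrite mulr1.
have [w0 w0l E0] := exp1 3 L Ll isT.
have [w4 w4l E4] := exp1 4 bern bl isT.
(* L (k.+3 - l) enters E0 multiplied by P ^+ l, so precision 3 - l suffices. *)
have [w1 w1l E1] := Lexp 3 k.+3 (leqnn _) isT.
have [w2 w2l E2] := Lexp 2 k.+2 (leqnSn _) isT.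
have [w3 w3l E3] := Lexp 1 k.+1 (leq_trans (leqnSn _) (leqnSn _)) isT.
exists (w0 + w1 + n / 2 * w2 + n * n1 * (2^-1 * 3^-1) * w3
        - (1 + I ^+ k.+3) * w4).
  by rewrite /n /n1; loc_closed.
rewrite gauss_power_sum_conv ?(leq_trans _ k_lt) // E0 E4 !big_ord_recr big_ord0 /=.
rewrite !subSS !subn0 E1 E2 E3 !big_ord_recr !big_ord0 /= !subSS !subn0.
rewrite !ffactSS !ffactn0 !muln1 !(natrM _ k.+3) !(natrM _ k.+2).
rewrite -/n -/n1 -/n2 -/P (_ : 1`! = 1)%N // (_ : 2`! = 2)%N //.
rewrite (_ : 3`! = 6)%N // (_ : 4`! = 24)%N //.
by field: I_sqr; rewrite !natC_neq0 // oner_neq0.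
Qed.

End Localization.

(** * The congruence for the Gaussian power sums *)

Lemma I_exp4 t : I ^+ (4 * t) = 1.
Proof.
have I4 : I ^+ 4 = 1.
  by rewrite !exprS expr0 mulr1 I_sqr mulrN1 mulrN I_sqr opprK.
by rewrite exprM I4 expr1n.
Qed.

Section Congruence.
Variables (p : nat) (p_prime : prime p).

(** With n = 4t + r, the terms of [gauss_power_sum_expansion] of order at most
p^(r+1) behave as follows, the linear part carrying the factor 1 + i^r.
For r = 0, -2 p B_n is the only term of order p.
For r = 1, B_n = 0 and the term of order p^2 comes from K_n and from B_(n-1).
For r = 2, the linear part vanishes, as does K_n, and the term of order p^3 is
the one in K_(n-1).
For r = 3, K_n and B_(n-1) are both of order p^2 and cancel, B_n, K_(n-1) and
B_(n-2) vanish, and the term of order p^4 comes from K_(n-2) and B_(n-3).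
The witnesses collect the remaining terms, divided by p^(r+2). *)
Lemma gauss_power_sum_congr t r :
  (0 < t)%N -> (r <= 3)%N -> ((4 * t + r).+1 < p)%N ->
  exists2 w, w \in gauss_loc p_prime &
    gauss_power_sum (4 * t + r) p =
      kappa r * ((4 * t + r) ^_ r)%:R * p%:R ^+ (r + 1) * bern (4 * t)
      + p%:R ^+ (r + 2) * w.
Proof.
(* Writing 4 * t as q.+4 lets the predecessors of the index compute. *)
case: t => // t _; set q := (4 * t)%N.
have Iq : I ^+ q.+4 = 1 by rewrite -(I_exp4 t.+1) mulnS.
have I5 : I ^+ q.+4.+1 = I by rewrite exprS Iq mulr1.
have I6 : I ^+ q.+4.+2 = -1 by rewrite exprS I5 I_sqr.
have I7 : I ^+ q.+4.+3 = - I by rewrite exprS I6 mulrN1.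
have odd_q : odd q = false by rewrite /q oddM.
have b5 : bern q.+4.+1 = 0 by rewrite bern_odd //= odd_q.
have b7 : bern q.+4.+3 = 0 by rewrite bern_odd //= odd_q.
have K5 := bern_conv_mod1 Iq.
have K6 := bern_conv_mod2 Iq b5.
have K7 := bern_conv_mod3 Iq.
have il := gauss_loc_I p_prime.
have nz := natC_neq0.
have -> : (4 * t.+1 = q.+4)%N by rewrite mulnS.
case: r => [|[|[|[|//]]]] _; rewrite ?(addn0, addnS) => n_lt.
all: have ltp j : (j <= q.+4)%N -> (j.+1 < p)%N
  by (move=> j_le; apply: leq_ltn_trans n_lt; rewrite ltnS (leq_trans j_le) //;
      do ?[exact: leqnn | apply: leqW]).
all: have Kl j : (j <= q.+4)%N -> bern_conv j \in gauss_loc p_prime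
  by move=> /ltp; apply: bern_conv_loc.
all: have bl j : (j <= q.+4)%N -> bern j \in gauss_loc p_prime
  by move=> /ltp; apply: bern_loc.
all: have inv j : (0 < j < 5)%N -> j%:R^-1 \in gauss_loc p_prime
  by (case/andP=> j_gt0 j_lt; rewrite gauss_loc_inv_nat // gtnNdvd //;
      apply: leq_ltn_trans (ltp 4 isT); apply: leqW).
- have [w wl ->] := gauss_power_sum_expansion p_prime n_lt.
  exists (bern_conv q.+4 + (1 + I) * 2^-1 * p%:R * q.+4%:R * bern_conv q.+3
    + I * 4^-1 * p%:R ^+ 2 * q.+4%:R * q.+3%:R * bern_conv q.+2
    - 2 * (q.+4%:R * 2^-1 * bern q.+3
      + p%:R * q.+4%:R * q.+3%:R * (2^-1 * 3^-1) * bern q.+2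
      + p%:R ^+ 2 * q.+4%:R * q.+3%:R * q.+2%:R * (2^-1 * 3^-1 * 4^-1)
        * bern q.+1)
    + p%:R ^+ 3 * w).
    by loc_closed.
  rewrite Iq ffactn0 /kappa /=.
  by field: I_sqr; rewrite !nz // oner_neq0.
- have [w wl ->] := gauss_power_sum_expansion p_prime n_lt.
  exists (I * 4^-1 * p%:R * q.+4.+1%:R * q.+4%:R * bern_conv q.+3
    - (1 + I) * (q.+4.+1%:R * q.+4%:R * (2^-1 * 3^-1) * bern q.+3
      + p%:R * q.+4.+1%:R * q.+4%:R * q.+3%:R * (2^-1 * 3^-1 * 4^-1)
        * bern q.+2)
    + (1 + I) * 2^-1 * q.+4.+1%:R * bern_conv q.+4 + p%:R ^+ 2 * w).
    by loc_closed.
  rewrite I5 K5 b5 ffactn1 /kappa /=.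
  by field: I_sqr; rewrite !nz // oner_neq0.
- have [w wl ->] := gauss_power_sum_expansion p_prime n_lt.
  exists (I * 4^-1 * q.+4.+2%:R * q.+4.+1%:R * bern_conv q.+4 + p%:R * w).
    by loc_closed.
  rewrite I6 K6 K5 !ffactSS ffactn0 muln1 natrM /kappa /=.
  by field: I_sqr; rewrite !nz // oner_neq0.
- have [w wl ->] := gauss_power_sum_expansion p_prime n_lt.
  exists w => //.
  rewrite I7 K7 K6 K5 b7 b5 !ffactSS ffactn0 muln1 !natrM /kappa /=.
  by field: I_sqr; rewrite !nz // oner_neq0.
Qed.

End Congruence.

(** * Valuations *)

Section Valuation.
Variables (p : nat) (p_prime : prime p).

Lemma loc_pmul m w : w \in loc p_prime ->
  (p%:Z ^+ m %| numq (p%:R ^+ m * w))%Z /\ p%:R ^+ m * w \in loc p_prime.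
Proof.
move=> wl; have xl : p%:R ^+ m * w \in loc p_prime.
  by rewrite rpredM ?rpredX ?rpred_nat.
split=> //; set x := _ * w in xl *.
have : (p%:Z ^+ m %| numq x * denq w)%Z.
  apply/dvdzP; exists (numq w * denq x); apply: (@intr_inj rat).
  by rewrite !intrM !numqE /x rmorphXn /=; ring.
by rewrite Gauss_dvdzl // coprimezE abszX coprimeXl // prime_coprime.
Qed.

Lemma logn_denq x : x \in loc p_prime -> logn p `|denq x| = 0%N.
Proof.
move=> xl; rewrite lognE (_ : (p %| `|denq x|)%N = false) ?andbF //.
exact: negPf xl.
Qed.

(** Lower bounds on the valuation are divisibility statements, which makes them
compatible with sums and products. If p divides the denominator then it does
not divide the numerator, and the valuation is negative. *)
Lemma vp_rat_ge m x :
  (m%:Z%:E <= vp_rat p x)%E <->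
  exists2 w, w \in loc p_prime & x = p%:R ^+ m * w.
Proof.
rewrite /vp_rat; case: eqP => [->|/eqP x_neq0].
  split=> [_|_]; last by rewrite leey.
  by exists 0; rewrite ?rpred0 ?mulr0.
have num_gt0 : (0 < `|numq x|)%N by rewrite absz_gt0 numq_eq0.
have pm_neq0 : (p%:R ^+ m : rat) != 0.
  by rewrite expf_neq0 // pnatr_eq0 -lt0n prime_gt0.
rewrite lee_fin; split=> [m_le | [w wl xE]].
  have [p_den|p_den] := boolP (p %| denq x)%Z.
    have: (p %| `|numq x|)%N = false.
      apply: contraTF (coprime_num_den x) => p_num.
      rewrite /coprime gtn_eqF // (leq_trans (prime_gt1 p_prime)) //.
      by rewrite dvdn_leq ?gcdn_gt0 ?num_gt0 // dvdn_gcd p_num.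
    move=> p_num; move: m_le; rewrite lognE p_num !andbF sub0r => m_le.
    have: (0 < logn p `|denq x|)%N.
      by rewrite logn_gt0 mem_primes p_prime absz_gt0 denq_neq0.
    rewrite -ltz_nat ltNge => /negP[]; rewrite -oppr_ge0.
    exact: le_trans m_le.
  exists (x / p%:R ^+ m); last by rewrite mulrC divfK.
  move: m_le; rewrite logn_denq // subr0 lez_nat.
  rewrite -pfactor_dvdn // => p_num.
  have /dvdzP[k kE] : (p%:Z ^+ m %| numq x)%Z by rewrite dvdzE abszX.
  apply: (loc_frac _ p_den).
  by rewrite mulrAC -numqE kE intrM rmorphXn mulfK // intr_int.
have [p_num xl] := loc_pmul m wl; rewrite -xE in p_num xl.
rewrite logn_denq // subr0 lez_nat.
by rewrite -pfactor_dvdn // -(absz_nat p) -abszX.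
Qed.

Lemma vp_ge m z :
  (m%:Z%:E <= vp p z)%E <->
  exists2 w, w \in gauss_loc p_prime & z = p%:R ^+ m * w.
Proof.
have pE : p%:R ^+ m = (p%:R ^+ m)%:C%C :> rat[i].
  by rewrite rmorphXn /= rmorph_nat.
rewrite /vp le_min; split.
  case/andP=> /vp_rat_ge[a al aE] /vp_rat_ge[b bl bE].
  exists (Complex a b); first exact/andP.
  case: z aE bE => x y /= -> ->; rewrite pE.
  by apply/eqP; rewrite eq_complex /= !mul0r subr0 addr0 !eqxx.
case=> -[a b] /andP[al bl] ->; rewrite pE /= !mul0r subr0 addr0.
by apply/andP; split; apply/vp_rat_ge; [exists a | exists b].
Qed.

Lemma ereal_int_ge_eq (m : int) (v : \bar int) :
  (m%:E <= v)%E -> ~~ ((m + 1)%:E <= v)%E -> v = m%:E.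
Proof.
case: v => [v| |] //; rewrite ?leey // !lee_fin => m_le.
by rewrite lezD1 -leNgt => v_le; congr _%:E; apply/eqP; rewrite eq_le v_le.
Qed.

(** As c is a unit at p, the leading term c p^m x has valuation at least m + 1
exactly when p divides x in the localization, that is when p divides its
numerator. *)
Lemma vp_ge_unit_mul m (c : rat[i]) x (w : rat[i]) :
  (exists2 d, d \in gauss_loc p_prime & d * c = 1) ->
  c \in gauss_loc p_prime -> x \in loc p_prime -> w \in gauss_loc p_prime ->
  (p %| numq x)%Z <->
  (m.+1%:Z%:E <= vp p (c * p%:R ^+ m * x%:C%C + p%:R ^+ m.+1 * w : rat[i])%R)%E.
Proof.
move=> [d dl dc] cl xl wl.
have pm_neq0 : (p%:R ^+ m : rat[i]) != 0.
  by rewrite expf_neq0 // natC_neq0 // prime_gt0.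
split.
  move=> p_num; have /vp_rat_ge[y yl ->] : (1%N%:Z%:E <= vp_rat p x)%E.
    rewrite /vp_rat; case: eqP => [_|/eqP x_neq0]; first by rewrite leey.
    rewrite lee_fin logn_denq // subr0 lez_nat.
    by rewrite logn_gt0 mem_primes p_prime absz_gt0 numq_eq0 x_neq0.
  apply/vp_ge; exists (c * y%:C%C + w).
    by rewrite rpredD ?rpredM ?gauss_locC.
  have -> : (p%:R ^+ 1 * y)%:C%C = p%:R * y%:C%C :> rat[i].
    by rewrite rmorphM expr1 rmorph_nat.
  by rewrite exprS; ring.
case/vp_ge => w' w'l E.
have xE : x%:C%C = p%:R * (d * (w' - w)).
  have dcx : x%:C%C = d * c * x%:C%C by rewrite dc mul1r.
  apply: (mulfI pm_neq0); rewrite dcx.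
  transitivity (d * (c * p%:R ^+ m * x%:C%C + p%:R ^+ m.+1 * w)
    - d * p%:R ^+ m.+1 * w); first by ring.
  by rewrite E exprS; ring.
have : (d * (w' - w)) \in gauss_loc p_prime by rewrite rpredM ?rpredB.
case: (d * (w' - w)) xE => a b xE /andP[al _].
have {xE} -> : x = p%:R ^+ 1 * a.
  have /eqP := xE; rewrite -(rmorph_nat toC) eq_complex /= mul0r subr0 expr1.
  by case/andP=> /eqP.
by have [] := loc_pmul 1 al; rewrite expr1.
Qed.

End Valuation.

(** * The constants kappa_r and the conclusion *)

Section KappaUnit.
Variables (p : nat) (p_prime : prime p).

Lemma kappa_loc r : (4 < p)%N -> (r <= 3)%N -> kappa r \in gauss_loc p_prime.
Proof.
move=> p_gt4 r_le; have il := gauss_loc_I p_prime.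
have inv j : (0 < j < 5)%N -> j%:R^-1 \in gauss_loc p_prime.
  by case/andP=> *; rewrite gauss_loc_inv_nat // gtnNdvd // (leq_trans _ p_gt4).
case: r r_le => [|[|[|[|//]]]] _; rewrite /kappa /=; try by loc_closed.
have -> : 12^-1 = 3^-1 * 4^-1 :> rat[i] by rewrite -invfM -natrM.
by loc_closed.
Qed.

Lemma kappa_unit r : (4 < p)%N -> (r <= 3)%N ->
  exists2 d, d \in gauss_loc p_prime & d * kappa r = 1.
Proof.
move=> p_gt4 r_le; have il := gauss_loc_I p_prime.
have i2 : 2^-1 \in gauss_loc p_prime.
  by rewrite gauss_loc_inv_nat // gtnNdvd // (leq_trans _ p_gt4).
exists (nth 0 [:: - 2^-1; - ((1 - I) * 2^-1); 2 * I; 6 * (1 + I)] r).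
  by case: r r_le => [|[|[|[|//]]]] _ /=; loc_closed.
by case: r r_le => [|[|[|[|//]]]] _; rewrite /kappa /=; field: I_sqr;
   exact: natC_neq0.
Qed.

End KappaUnit.

Lemma prime_ndvd_ffact p n m :
  prime p -> (n < p)%N -> (m <= n)%N -> ~~ (p %| n ^_ m)%N.
Proof.
move=> p_prime n_lt; elim: m => [|m IHm] m_le.
  by rewrite ffactn0 dvdn1 gtn_eqF ?prime_gt1.
rewrite ffactnSr Euclid_dvdM // negb_or IHm ?(ltnW m_le) //=.
by rewrite gtnNdvd ?subn_gt0 // (leq_ltn_trans (leq_subr _ _)).
Qed.

Theorem theorem4 (p t r : nat) (p_prime : prime p) (p_odd : odd p)
    (t_ge1 : (1 <= t)%N) (r_le3 : (r <= 3)%N)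
    (ptr : (4 * t + r <= p - 2)%N) :
  [/\ gauss_loc_eqmod p (r + 2)
        (gauss_power_sum (4 * t + r) p)
        (kappa r * ((4 * t + r) ^_ r)%:R * p%:R ^+ (r + 1)
         * Complex (bernoulli (4 * t)) 0),
      ((r + 1)%N%:Z%:E <= vp p (gauss_power_sum (4 * t + r) p))%E,
      vp p (gauss_power_sum (4 * t + r) p) = (r + 1)%N%:Z%:E
        <-> ~~ (p %| numq (bernoulli (4 * t)))%Z,
      (p %| numq (bernoulli (4 * t)))%Z
        <-> ((r + 2)%N%:Z%:E <= vp p (gauss_power_sum (4 * t + r) p))%E
    & (p %| numq (bernoulli (4 * t)))%Z ->
      forall s : nat, (s <= 3)%N -> (4 * t + s <= p - 2)%N ->
        ((s + 2)%N%:Z%:E <= vp p (gauss_power_sum (4 * t + s) p))%E].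
Proof.
have p_gt4 : (4 < p)%N.
  case: t t_ge1 ptr => // t _; rewrite leq_subRL ?prime_gt1 // mulnS.
  by rewrite -addnA addnA; apply: leq_trans; apply: leq_trans (leq_addr _ _).
have lt_p s : (4 * t + s <= p - 2)%N -> ((4 * t + s).+1 < p)%N.
  by rewrite leq_subRL ?prime_gt1.
have bl : bernoulli (4 * t) \in loc p_prime.
  have := lt_p r ptr => n_lt.
  suff /andP[] : bern (4 * t) \in gauss_loc p_prime by [].
  by apply: bern_loc; apply: leq_ltn_trans n_lt; rewrite ltnS leq_addr.
pose c s : rat[i] := kappa s * ((4 * t + s) ^_ s)%:R.
have cl s : (s <= 3)%N -> c s \in gauss_loc p_prime.
  by move=> s_le; rewrite rpredM ?rpred_nat ?kappa_loc.
have c_unit s : (s <= 3)%N -> (4 * t + s <= p - 2)%N ->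
    exists2 d, d \in gauss_loc p_prime & d * c s = 1.
  move=> s_le /lt_p n_lt; have [d dl dE] := kappa_unit p_prime p_gt4 s_le.
  have ndvd : ~~ (p %| (4 * t + s) ^_ s)%N.
    by rewrite prime_ndvd_ffact ?leq_addl // ltnW.
  exists (d * ((4 * t + s) ^_ s)%:R^-1).
    by rewrite rpredM ?gauss_loc_inv_nat.
  rewrite mulrACA dE mul1r mulVf // natC_neq0 // lt0n.
  by apply: contra ndvd => /eqP->.
have irr s : (s <= 3)%N -> (4 * t + s <= p - 2)%N ->
    (p %| numq (bernoulli (4 * t)))%Z
    <-> ((s + 2)%N%:Z%:E <= vp p (gauss_power_sum (4 * t + s) p))%E.
  move=> s_le n_le.
  have [w wl ->] := gauss_power_sum_congr p_prime t_ge1 s_le (lt_p _ n_le).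
  rewrite addn2 -addn1 addn1 -[s.+1]addn1.
  exact: vp_ge_unit_mul (c_unit s s_le n_le) (cl s s_le) bl wl.
have [w wl GE] := gauss_power_sum_congr p_prime t_ge1 r_le3 (lt_p _ ptr).
have ge1 : ((r + 1)%N%:Z%:E <= vp p (gauss_power_sum (4 * t + r) p))%E.
  apply/(vp_ge p_prime); exists (c r * bern (4 * t) + p%:R * w).
    by apply: rpredD; apply: rpredM; rewrite ?cl ?gauss_locC ?rpred_nat.
  by rewrite GE addn1 addn2 !exprS /c; ring.
have [irr1 irr2] := irr r r_le3 ptr.
split=> //.
- split.
  + have /(vp_ge p_prime)[w' w'l ->] := ge1.
    rewrite -[_ \in _]/(_ \in gauss_loc p_prime).
    by apply: rpredM => //; rewrite rpredX ?rpred_nat.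
  + rewrite -[_ \in _]/(_ \in gauss_loc p_prime).
    apply: rpredM; last exact: gauss_locC.
    by apply: rpredM; rewrite ?rpredX ?rpred_nat ?cl.
  + by exists w; rewrite // GE /bern addrAC subrr add0r.
- split=> [vE | ].
    apply/negP => /irr1; rewrite vE lee_fin lez_nat.
    by rewrite leq_add2l.
  move=> nirr; apply: ereal_int_ge_eq ge1 _.
  by apply: contra nirr => H; apply: irr2; rewrite addn2 -addn1 -[r.+1]addn1.
- by move=> /irr{}irr s s_le n_le; apply/irr.
Qed.
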